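(* Let $p:\mathcal E\to\mathcal B$ be a cartesian closed bifibration, let $\mathcal C$ be a cartesian closed category, let $F,G:\mathcal C\to\mathcal B$ be cartesian functors, and let $\theta:F\Rightarrow G$ be a natural transformation all of whose components $\theta_C:F(C)\to G(C)$ are reflective morphisms for $p$. Then the functor $$\theta^*:G^*(\mathcal E)\to F^*(\mathcal E),\qquad (C,V)\mapsto (C,\theta_C^*V),$$ is a cartesian closed functor.
   Context: A functor $p:\mathcal E\to\mathcal B$ is a fibration (resp. opfibration) if every base morphism $f:X\to Y$ has cartesian liftings $f^*(V)\to V$ for $p(V)=Y$ (resp. cocartesian liftings $U\to f_!(U)$ for $p(U)=X$); a bifibration is both. A cartesian functor is one between cartesian categories preserving finite products strictly; a cartesian closed functor is one between cartesian closed categories preserving finite products and internal homs strictly; $p$ is a cartesian closed bifibration if it is a bifibration, $\mathcal E,\mathcal B$ are cartesian closed and $p$ is a cartesian closed functor. For $F:\mathcal C\to\mathcal B$, $F^*(\mathcal E)$ is the pullback of categories of $p$ along $F$: objects $(C,U)$ with $p(U)=F(C)$, morphisms $(f,u)$ with $p(u)=F(f)$; the categories $F^*(\mathcal E),G^*(\mathcal E)$ are cartesian closed. Writing $\mathcal E_X$ for the fiber over $X$, a morphism $f:X\to Y$ of $\mathcal B$ is reflective if the adjunction $f_!\dashv f^*$ between $\mathcal E_X$ and $\mathcal E_Y$ is reflective, i.e. the counit $f_!f^*U\to U$ is an isomorphism for every $U\in\mathcal E_Y$.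
   Formalization: Strict preservation fails for arbitrary liftings and given structures; instead θ^* is shown to preserve finite products and internal homs up to canonical isomorphism for all cartesian closed structures on G^*(E), F^*(E), and strictly for suitably chosen ones. *)

(* Defs.v *)
From Stdlib Require Import ClassicalEpsilon.

Set Implicit Arguments.
Unset Strict Implicit.
Unset Printing Implicit Defensive.

(* ** Categories, functors, natural transformations *)

Record category := Category {
  ob :> Type;
  hom : ob -> ob -> Type;
  idm : forall A, hom A A;
  comp : forall A B C, hom B C -> hom A B -> hom A C;
  comp_idl : forall A B (f : hom A B), comp (idm B) f = f;
  comp_idr : forall A B (f : hom A B), comp f (idm A) = f;
  comp_assoc : forall A B C D (h : hom C D) (g : hom B C) (f : hom A B),
    comp h (comp g f) = comp (comp h g) f
}.
Arguments hom {_} _ _.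
Arguments idm {_} _.
Arguments comp {_ _ _ _} _ _.

Infix "\o" := comp (at level 40, left associativity).

(* [f =~ g]: equality of arrows whose endpoints are not syntactically equal;
   it entails that the domains, and the codomains, are equal.  Strict equations
   between objects are handled through it, so that no cast is needed. *)
Inductive hom_eq {C : category} {A B : C} (f : hom A B) :
    forall {A' B' : C}, hom A' B' -> Prop :=
  hom_eq_refl : hom_eq f f.

Infix "=~" := hom_eq (at level 70, no associativity).

Definition inverse_of {C : category} {A B : C} (f : hom A B) (g : hom B A) :=
  g \o f = idm A /\ f \o g = idm B.

Definition is_iso {C : category} {A B : C} (f : hom A B) :=
  exists g, inverse_of f g.

Record functor (C D : category) := Functor {
  fob :> C -> D;
  fmap : forall A B, hom A B -> hom (fob A) (fob B);
  fmap_id : forall A, fmap (idm A) = idm (fob A);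
  fmap_comp : forall A B X (g : hom B X) (f : hom A B),
    fmap (g \o f) = fmap g \o fmap f
}.
Arguments fmap {_ _} _ {_ _} _.

Record nat_trans {C D : category} (F G : functor C D) := NatTrans {
  component :> forall A, hom (F A) (G A);
  naturality : forall A B (f : hom A B),
    component B \o fmap F f = fmap G f \o component A
}.

(* ** Cartesian closed categories, with chosen structure *)

Record cartesian (C : category) := Cartesian {
  one : C;
  bang : forall A, hom A one;
  bang_uniq : forall A (f : hom A one), f = bang A;
  prd : C -> C -> C;
  pr1 : forall A B, hom (prd A B) A;
  pr2 : forall A B, hom (prd A B) B;
  pairing : forall X A B, hom X A -> hom X B -> hom X (prd A B);
  pr1_pairing : forall X A B (f : hom X A) (g : hom X B),
    pr1 A B \o pairing f g = f;
  pr2_pairing : forall X A B (f : hom X A) (g : hom X B),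
    pr2 A B \o pairing f g = g;
  pairing_uniq : forall X A B (h : hom X (prd A B)),
    h = pairing (pr1 A B \o h) (pr2 A B \o h)
}.
Arguments pairing {_} _ {_ _ _} _ _.

Record cartesian_closed (C : category) := CartesianClosed {
  cc_cart :> cartesian C;
  ihom : C -> C -> C;
  ev : forall A B, hom (prd cc_cart (ihom A B) A) B;
  curry : forall X A B, hom (prd cc_cart X A) B -> hom X (ihom A B);
  ev_curry : forall X A B (f : hom (prd cc_cart X A) B),
    ev A B \o pairing cc_cart (curry f \o pr1 cc_cart X A) (pr2 cc_cart X A)
    = f;
  curry_uniq : forall X A B (g : hom X (ihom A B)),
    g = curry (ev A B \o
          pairing cc_cart (g \o pr1 cc_cart X A) (pr2 cc_cart X A))
}.
Arguments curry {_} _ {_ _ _} _.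

(* Strict preservation.  Preservation of [bang], [pairing] and [curry] follows
   from their uniqueness. *)
Record cartesian_functor {C D : category} (SC : cartesian C) (SD : cartesian D)
    (F : functor C D) : Prop := CartesianFunctor {
  pres_one : F (one SC) = one SD;
  pres_prd : forall A B, F (prd SC A B) = prd SD (F A) (F B);
  pres_pr1 : forall A B, fmap F (pr1 SC A B) =~ pr1 SD (F A) (F B);
  pres_pr2 : forall A B, fmap F (pr2 SC A B) =~ pr2 SD (F A) (F B)
}.

Record cartesian_closed_functor {C D : category}
    (SC : cartesian_closed C) (SD : cartesian_closed D)
    (F : functor C D) : Prop := CartesianClosedFunctor {
  ccf_cart : cartesian_functor SC SD F;
  pres_ihom : forall A B, F (ihom SC A B) = ihom SD (F A) (F B);
  pres_ev : forall A B, fmap F (ev SC A B) =~ ev SD (F A) (F B)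
}.

(* Preservation up to canonical isomorphism: the comparison arrows
   F 1 -> 1,  F (A x B) -> F A x F B  and  F [A, B] -> [F A, F B]
   are invertible.  The last one is the transpose of
   F [A, B] x F A ~ F ([A, B] x A) -> F B. *)
Definition prd_comparison {C D : category} (SC : cartesian C)
    (SD : cartesian D) (F : functor C D) (A B : C) :
    hom (F (prd SC A B)) (prd SD (F A) (F B)) :=
  pairing SD (fmap F (pr1 SC A B)) (fmap F (pr2 SC A B)).

Record weak_cartesian_closed_functor {C D : category}
    (SC : cartesian_closed C) (SD : cartesian_closed D)
    (F : functor C D) : Prop := WeakCartesianClosedFunctor {
  wpres_one : is_iso (bang SD (F (one SC)));
  wpres_prd : forall A B, is_iso (prd_comparison SC SD F A B);
  wpres_ihom : forall A B
    (k : hom (prd SD (F (ihom SC A B)) (F A)) (F (prd SC (ihom SC A B) A))),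
    inverse_of (prd_comparison SC SD F (ihom SC A B) A) k ->
    is_iso (curry SD (fmap F (ev SC A B) \o k))
}.

(* ** Calculus of [=~] *)

Lemma hom_eq_inv {C : category} {A B A' B' : C} (f : hom A B) (g : hom A' B') :
  f =~ g -> exists (eA : A = A') (eB : B = B'),
    g = eq_rect B (fun Y => hom A' Y) (eq_rect A (fun X => hom X B) f A' eA)
          B' eB.
Proof. intros H; destruct H; exists eq_refl, eq_refl; reflexivity. Qed.

Lemma hom_eq_eq {C : category} {A B : C} (f g : hom A B) : f =~ g -> f = g.
Proof.
intros H; destruct (hom_eq_inv H) as [eA [eB ->]].
rewrite (proof_irrelevance _ eA eq_refl), (proof_irrelevance _ eB eq_refl).
reflexivity.
Qed.

Lemma eq_hom_eq {C : category} {A B : C} (f g : hom A B) : f = g -> f =~ g.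
Proof. intros ->; constructor. Qed.

Lemma hom_eq_sym {C : category} {A B A' B' : C} (f : hom A B)
  (g : hom A' B') : f =~ g -> g =~ f.
Proof. intros H; destruct H; constructor. Qed.

Lemma hom_eq_trans {C : category} {A B A' B' A'' B'' : C} (f : hom A B)
  (g : hom A' B') (h : hom A'' B'') : f =~ g -> g =~ h -> f =~ h.
Proof. intros H; destruct H; auto. Qed.

Lemma hom_eq_id {C : category} {A B : C} : A = B -> idm A =~ idm B.
Proof. intros ->; constructor. Qed.

Lemma hom_eq_comp {C : category} {X Y Z X' Y' Z' : C}
  (g : hom Y Z) (f : hom X Y) (g' : hom Y' Z') (f' : hom X' Y') :
  g =~ g' -> f =~ f' -> g \o f =~ g' \o f'.
Proof.
intros Hg Hf.
destruct (hom_eq_inv Hg) as [eY [eZ _]], (hom_eq_inv Hf) as [eX _].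
subst; rewrite (hom_eq_eq Hg), (hom_eq_eq Hf); constructor.
Qed.

(* ** Fibrations and opfibrations *)

Record fiber_ob {E B : category} (p : functor E B) (X : B) := FiberOb {
  fib_ob :> E;
  fib_over : p fib_ob = X
}.

Record fiber_hom {E B : category} (p : functor E B) (X : B)
    (U V : fiber_ob p X) := FiberHom {
  fib_hom :> hom U V;
  fib_hom_over : fmap p fib_hom =~ idm X
}.

Lemma fiber_hom_eq {E B : category} (p : functor E B) (X : B)
  (U V : fiber_ob p X) (u v : fiber_hom U V) :
  fib_hom u = fib_hom v -> u = v.
Proof.
destruct u as [u hu], v as [v hv]; simpl; intros e; subst v.
now rewrite (proof_irrelevance _ hu hv).
Qed.

Section Fiber.
Variables (E B : category) (p : functor E B) (X : B).

Lemma fiber_id_over (U : fiber_ob p X) : fmap p (idm (fib_ob U)) =~ idm X.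
Proof. rewrite fmap_id; apply hom_eq_id, fib_over. Qed.

Lemma fiber_comp_over (U V W : fiber_ob p X) (v : fiber_hom V W)
  (u : fiber_hom U V) : fmap p (fib_hom v \o fib_hom u) =~ idm X.
Proof.
rewrite fmap_comp, <- (comp_idl (idm X)).
apply hom_eq_comp; apply fib_hom_over.
Qed.

Definition fiber : category.
Proof.
refine (@Category (fiber_ob p X) (@fiber_hom E B p X)
  (fun U => FiberHom (fiber_id_over U))
  (fun U V W v u => FiberHom (fiber_comp_over v u)) _ _ _);
intros; apply fiber_hom_eq; simpl.
- apply comp_idl.
- apply comp_idr.
- apply comp_assoc.
Defined.
End Fiber.

Definition is_cartesian {E B : category} (p : functor E B) {U V : E}
    (phi : hom U V) : Prop :=
  forall (W : E) (w : hom W V) (g : hom (p W) (p U)),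
    fmap p phi \o g = fmap p w ->
    exists! h : hom W U, fmap p h = g /\ phi \o h = w.

Definition is_cocartesian {E B : category} (p : functor E B) {U V : E}
    (psi : hom U V) : Prop :=
  forall (W : E) (w : hom U W) (g : hom (p V) (p W)),
    g \o fmap p psi = fmap p w ->
    exists! h : hom V W, fmap p h = g /\ h \o psi = w.

Definition fibration {E B : category} (p : functor E B) : Prop :=
  forall (X Y : B) (f : hom X Y) (V : fiber_ob p Y),
    exists (U : fiber_ob p X) (phi : hom U V),
      fmap p phi =~ f /\ is_cartesian p phi.

Definition opfibration {E B : category} (p : functor E B) : Prop :=
  forall (X Y : B) (f : hom X Y) (U : fiber_ob p X),
    exists (V : fiber_ob p Y) (psi : hom U V),
      fmap p psi =~ f /\ is_cocartesian p psi.

Definition bifibration {E B : category} (p : functor E B) : Prop :=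
  fibration p /\ opfibration p.

Definition cartesian_closed_bifibration {E B : category}
    (SE : cartesian_closed E) (SB : cartesian_closed B) (p : functor E B) :
    Prop :=
  bifibration p /\ cartesian_closed_functor SE SB p.

(* A choice of liftings: [pull f V] is f^*(V) and [push f U] is f_!(U). *)
Record cleavage {E B : category} (p : functor E B) := Cleavage {
  pull : forall (X Y : B), hom X Y -> fiber_ob p Y -> fiber_ob p X;
  cart_lift : forall (X Y : B) (f : hom X Y) (V : fiber_ob p Y),
    hom (pull f V) V;
  cart_lift_over : forall (X Y : B) (f : hom X Y) (V : fiber_ob p Y),
    fmap p (cart_lift f V) =~ f;
  cart_lift_cartesian : forall (X Y : B) (f : hom X Y) (V : fiber_ob p Y),
    is_cartesian p (cart_lift f V)
}.
Arguments pull {_ _ _} _ {_ _} _ _.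
Arguments cart_lift {_ _ _} _ {_ _} _ _.
Arguments cart_lift_over {_ _ _} _ {_ _} _ _.
Arguments cart_lift_cartesian {_ _ _} _ {_ _} _ _.

Record opcleavage {E B : category} (p : functor E B) := Opcleavage {
  push : forall (X Y : B), hom X Y -> fiber_ob p X -> fiber_ob p Y;
  cocart_lift : forall (X Y : B) (f : hom X Y) (U : fiber_ob p X),
    hom U (push f U);
  cocart_lift_over : forall (X Y : B) (f : hom X Y) (U : fiber_ob p X),
    fmap p (cocart_lift f U) =~ f;
  cocart_lift_cocartesian : forall (X Y : B) (f : hom X Y) (U : fiber_ob p X),
    is_cocartesian p (cocart_lift f U)
}.
Arguments push {_ _ _} _ {_ _} _ _.
Arguments cocart_lift {_ _ _} _ {_ _} _ _.
Arguments cocart_lift_over {_ _ _} _ {_ _} _ _.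
Arguments cocart_lift_cocartesian {_ _ _} _ {_ _} _ _.

Lemma cartesian_factor {E B : category} (p : functor E B) (X Y Z : B)
  (U : fiber_ob p X) (V : fiber_ob p Y) (W : fiber_ob p Z)
  (f : hom X Y) (g : hom Z X) (phi : hom U V) (w : hom W V) :
  is_cartesian p phi -> fmap p phi =~ f -> fmap p w =~ f \o g ->
  exists! h : hom W U, fmap p h =~ g /\ phi \o h = w.
Proof.
destruct U as [U eU], V as [V eV], W as [W eW]; simpl in *.
subst X Y Z; intros Hc Hf Hw.
apply hom_eq_eq in Hf; apply hom_eq_eq in Hw; subst f.
destruct (Hc W w g (eq_sym Hw)) as [h [[h1 h2] hu]].
exists h; split; [split; [now apply eq_hom_eq | exact h2] |].
intros k [k1 k2]; apply hu; split; [now apply hom_eq_eq | exact k2].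
Qed.

Lemma cocartesian_factor {E B : category} (p : functor E B) (X Y Z : B)
  (U : fiber_ob p X) (V : fiber_ob p Y) (W : fiber_ob p Z)
  (f : hom X Y) (g : hom Y Z) (psi : hom U V) (w : hom U W) :
  is_cocartesian p psi -> fmap p psi =~ f -> fmap p w =~ g \o f ->
  exists! h : hom V W, fmap p h =~ g /\ h \o psi = w.
Proof.
destruct U as [U eU], V as [V eV], W as [W eW]; simpl in *.
subst X Y Z; intros Hc Hf Hw.
apply hom_eq_eq in Hf; apply hom_eq_eq in Hw; subst f.
destruct (Hc W w g (eq_sym Hw)) as [h [[h1 h2] hu]].
exists h; split; [split; [now apply eq_hom_eq | exact h2] |].
intros k [k1 k2]; apply hu; split; [now apply hom_eq_eq | exact k2].
Qed.

Definition the {T : Type} {P : T -> Prop} (H : exists! x, P x) : T :=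
  proj1_sig (constructive_indefinite_description _ H).

Lemma the_spec {T : Type} {P : T -> Prop} (H : exists! x, P x) : P (the H).
Proof.
unfold the; destruct (constructive_indefinite_description _ H) as [x [hx hu]].
exact hx.
Qed.

Lemma the_uniq {T : Type} {P : T -> Prop} (H : exists! x, P x) (y : T) :
  P y -> the H = y.
Proof.
unfold the; destruct (constructive_indefinite_description _ H) as [x [hx hu]].
apply hu.
Qed.

Section Reflective.
Variables (E B : category) (p : functor E B).
Variables (cl : cleavage p) (ocl : opcleavage p).
Variables (X Y : B) (f : hom X Y).

Lemma counit_exists (V : fiber_ob p Y) :
  exists! e : hom (push ocl f (pull cl f V)) V,
    fmap p e =~ idm Y /\ e \o cocart_lift ocl f (pull cl f V) = cart_lift cl f V.
Proof.
apply (cocartesian_factor (f := f)).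
- apply cocart_lift_cocartesian.
- apply cocart_lift_over.
- rewrite comp_idl; apply cart_lift_over.
Qed.

(* The transpose of the identity of f^* V under the adjunction f_! -| f^*: a
   vertical arrow out of f_! f^* V corresponds to its composite with the
   cocartesian lifting, and a vertical arrow into f^* V to its composite with
   the cartesian lifting. *)
Definition counit (V : fiber p Y) :
    @hom (fiber p Y) (push ocl f (pull cl f V)) V :=
  FiberHom (proj1 (the_spec (counit_exists V))).

Definition reflective : Prop := forall V : fiber p Y, is_iso (counit V).
End Reflective.

(* ** The pullback F^*(E) of a functor p : E -> B along F : C -> B *)

Record pb_ob {E B C : category} (p : functor E B) (F : functor C B) := PbOb {
  pb_base : C;
  pb_fib : fiber_ob p (F pb_base)
}.
Arguments PbOb {_ _ _ _ _} _ _.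

Record pb_hom {E B C : category} (p : functor E B) (F : functor C B)
    (U V : pb_ob p F) := PbHom {
  pb_bhom : hom (pb_base U) (pb_base V);
  pb_fhom : hom (pb_fib U) (pb_fib V);
  pb_over : fmap p pb_fhom =~ fmap F pb_bhom
}.

Lemma pb_hom_eq {E B C : category} (p : functor E B) (F : functor C B)
  (U V : pb_ob p F) (u v : pb_hom U V) :
  pb_bhom u = pb_bhom v -> pb_fhom u = pb_fhom v -> u = v.
Proof.
destruct u as [f u hu], v as [g v hv]; simpl; intros e1 e2; subst g v.
now rewrite (proof_irrelevance _ hu hv).
Qed.

Section Pullback.
Variables (E B C : category) (p : functor E B) (F : functor C B).

Lemma pb_id_over (U : pb_ob p F) :
  fmap p (idm (fib_ob (pb_fib U))) =~ fmap F (idm (pb_base U)).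
Proof. rewrite !fmap_id; apply hom_eq_id, fib_over. Qed.

Lemma pb_comp_over (U V W : pb_ob p F) (v : pb_hom V W) (u : pb_hom U V) :
  fmap p (pb_fhom v \o pb_fhom u) =~ fmap F (pb_bhom v \o pb_bhom u).
Proof. rewrite !fmap_comp; apply hom_eq_comp; apply pb_over. Qed.

Definition pullback : category.
Proof.
refine (@Category (pb_ob p F) (@pb_hom E B C p F)
  (fun U => PbHom (pb_id_over U))
  (fun U V W v u => PbHom (pb_comp_over v u)) _ _ _);
intros; apply pb_hom_eq; simpl.
- apply comp_idl.
- apply comp_idl.
- apply comp_idr.
- apply comp_idr.
- apply comp_assoc.
- apply comp_assoc.
Defined.
End Pullback.

(* ** The functor theta^* : G^*(E) -> F^*(E) *)

Section ThetaStar.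
Variables (E B C : category) (p : functor E B) (cl : cleavage p).
Variables (F G : functor C B) (theta : nat_trans F G).

Definition theta_star_ob (V : pb_ob p G) : pb_ob p F :=
  PbOb (pb_base V) (pull cl (theta (pb_base V)) (pb_fib V)).

Definition theta_star_lift (V : pb_ob p G) :
    hom (pb_fib (theta_star_ob V)) (pb_fib V) :=
  cart_lift cl (theta (pb_base V)) (pb_fib V).

Lemma theta_star_exists (V W : pb_ob p G) (v : pb_hom V W) :
  exists! h : hom (pb_fib (theta_star_ob V)) (pb_fib (theta_star_ob W)),
    fmap p h =~ fmap F (pb_bhom v) /\
    theta_star_lift W \o h = pb_fhom v \o theta_star_lift V.
Proof.
apply (cartesian_factor (f := theta (pb_base W))).
- apply cart_lift_cartesian.
- apply cart_lift_over.
- rewrite naturality, fmap_comp; apply hom_eq_comp.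
  + apply pb_over.
  + apply cart_lift_over.
Qed.

Definition theta_star_hom (V W : pb_ob p G) (v : pb_hom V W) :
    pb_hom (theta_star_ob V) (theta_star_ob W) :=
  PbHom (proj1 (the_spec (theta_star_exists v))).

Lemma theta_star_homE (V W : pb_ob p G) (v : pb_hom V W) :
  theta_star_lift W \o pb_fhom (theta_star_hom v)
  = pb_fhom v \o theta_star_lift V.
Proof. exact (proj2 (the_spec (theta_star_exists v))). Qed.

Definition theta_star : functor (pullback p G) (pullback p F).
Proof.
refine (@Functor (pullback p G) (pullback p F)
          theta_star_ob theta_star_hom _ _).
- intros V; apply pb_hom_eq; [reflexivity |].
  apply the_uniq; split; simpl.
  + apply (@pb_id_over E B C p F (theta_star_ob V)).
  + now rewrite comp_idr, comp_idl.
- intros U V W w v; apply pb_hom_eq; [reflexivity |].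
  apply the_uniq; split.
  + exact (pb_comp_over (theta_star_hom w) (theta_star_hom v)).
  + change (theta_star_lift W \o
      (pb_fhom (theta_star_hom w) \o pb_fhom (theta_star_hom v))
      = (pb_fhom w \o pb_fhom v) \o theta_star_lift U).
    now rewrite comp_assoc, theta_star_homE, <- comp_assoc, theta_star_homE,
      comp_assoc.
Defined.
End ThetaStar.
Arguments theta_star {_ _ _ _} _ {_ _} _.

(* Main.v *)
Require Import Defs.
From Stdlib Require Import ClassicalEpsilon.

(* The functor [theta^*] exhibits [G^*(E)] as a reflective subcategory of
   [F^*(E)]. Reflectivity of [theta_C] says that the cartesian liftings
   [theta_C^* V -> V] are also cocartesian, so [theta^*] is fully faithful, and
   [(C, U) |-> (C, theta_C! U)] is left adjoint to it. As [p] preserves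
   internal homs, products of cocartesian arrows are cocartesian (transpose,
   factor, and transpose back in each variable), whence the reflector preserves
   the products [X x theta^* A], which makes [theta^*] preserve exponentials.
   Any fully faithful functor preserving the structure up to isomorphism
   preserves it strictly for a suitable choice of structure on both sides. *)

Set Implicit Arguments.
Unset Strict Implicit.

(** * Calculus of binary products: functoriality and symmetry *)

Section Cartesian.
Variables (C : category) (S : cartesian C).

Lemma pairing_comp (X Y A B : C) (f : hom Y A) (g : hom Y B) (h : hom X Y) :
  pairing S f g \o h = pairing S (f \o h) (g \o h).
Proof.
rewrite (pairing_uniq (pairing S f g \o h)), !comp_assoc.
now rewrite pr1_pairing, pr2_pairing.
Qed.

Lemma pairing_ext (X A B : C) (h k : hom X (prd S A B)) :
  pr1 S A B \o h = pr1 S A B \o k -> pr2 S A B \o h = pr2 S A B \o k -> h = k.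
Proof.
intros e1 e2; rewrite (pairing_uniq h), (pairing_uniq k); congruence.
Qed.

Lemma pairing_id (A B : C) : pairing S (pr1 S A B) (pr2 S A B) = idm _.
Proof. now apply pairing_ext; rewrite ?pr1_pairing, ?pr2_pairing, comp_idr. Qed.

Definition prd_map (A A' B B' : C) (f : hom A A') (g : hom B B') :
    hom (prd S A B) (prd S A' B') :=
  pairing S (f \o pr1 S A B) (g \o pr2 S A B).

Lemma prd_map_pairing (X A A' B B' : C) (f : hom A A') (g : hom B B')
  (a : hom X A) (b : hom X B) :
  prd_map f g \o pairing S a b = pairing S (f \o a) (g \o b).
Proof.
unfold prd_map; rewrite pairing_comp, <- !comp_assoc.
now rewrite pr1_pairing, pr2_pairing.
Qed.

Lemma prd_map_comp (A A' A'' B B' B'' : C) (f : hom A A') (g : hom B B')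
  (f' : hom A' A'') (g' : hom B' B'') :
  prd_map f' g' \o prd_map f g = prd_map (f' \o f) (g' \o g).
Proof.
unfold prd_map at 2; rewrite prd_map_pairing, !comp_assoc; reflexivity.
Qed.

Lemma prd_map_idr (A A' B : C) (f : hom A A') :
  prd_map f (idm B) = pairing S (f \o pr1 S A B) (pr2 S A B).
Proof. unfold prd_map; now rewrite comp_idl. Qed.

Lemma prd_map_id (A B : C) : prd_map (idm A) (idm B) = idm _.
Proof. unfold prd_map; rewrite !comp_idl; apply pairing_id. Qed.

Lemma pr1_prd_map (A A' B B' : C) (f : hom A A') (g : hom B B') :
  pr1 S A' B' \o prd_map f g = f \o pr1 S A B.
Proof. apply pr1_pairing. Qed.

Lemma pr2_prd_map (A A' B B' : C) (f : hom A A') (g : hom B B') :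
  pr2 S A' B' \o prd_map f g = g \o pr2 S A B.
Proof. apply pr2_pairing. Qed.

Definition swap (A B : C) : hom (prd S A B) (prd S B A) :=
  pairing S (pr2 S A B) (pr1 S A B).

Lemma swap_pairing (X A B : C) (f : hom X A) (g : hom X B) :
  swap A B \o pairing S f g = pairing S g f.
Proof.
unfold swap; now rewrite pairing_comp, pr1_pairing, pr2_pairing.
Qed.

Lemma swap_swap (A B : C) : swap B A \o swap A B = idm _.
Proof. unfold swap at 2; rewrite swap_pairing; apply pairing_id. Qed.

Lemma swap_prd_map (A A' B B' : C) (f : hom A A') (g : hom B B') :
  swap A' B' \o prd_map f g = prd_map g f \o swap A B.
Proof.
unfold prd_map at 1, swap at 2.
now rewrite swap_pairing, prd_map_pairing.
Qed.

End Cartesian.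
Arguments prd_map {C} S {A A' B B'} f g.
Arguments swap {C} S A B.

(** * Transposition across exponentials and its naturality in the domain *)

Section CartesianClosed.
Variables (C : category) (S : cartesian_closed C).

Definition uncurry (X A B : C) (g : hom X (ihom S A B)) : hom (prd S X A) B :=
  ev S A B \o prd_map S g (idm A).

Lemma uncurryE (X A B : C) (g : hom X (ihom S A B)) :
  uncurry g = ev S A B \o pairing S (g \o pr1 S X A) (pr2 S X A).
Proof. unfold uncurry; now rewrite prd_map_idr. Qed.

Lemma uncurry_curry (X A B : C) (f : hom (prd S X A) B) :
  uncurry (curry S f) = f.
Proof. rewrite uncurryE; apply ev_curry. Qed.

Lemma curry_uncurry (X A B : C) (g : hom X (ihom S A B)) :
  curry S (uncurry g) = g.
Proof. rewrite uncurryE; symmetry; apply curry_uniq. Qed.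

Lemma uncurry_comp (X Y A B : C) (g : hom Y (ihom S A B)) (h : hom X Y) :
  uncurry (g \o h) = uncurry g \o prd_map S h (idm A).
Proof.
unfold uncurry; now rewrite <- comp_assoc, prd_map_comp, comp_idl.
Qed.

Lemma curry_comp (X Y A B : C) (f : hom (prd S Y A) B) (h : hom X Y) :
  curry S f \o h = curry S (f \o prd_map S h (idm A)).
Proof.
rewrite <- (curry_uncurry (curry S f \o h)).
now rewrite uncurry_comp, uncurry_curry.
Qed.

End CartesianClosed.

(** * Transport of arrows along equations of objects, and congruence of the structure for [=~] *)

Lemma hom_eq_cast {C : category} {A B A' B' : C} (f : hom A B) :
  A = A' -> B = B' -> exists f' : hom A' B', f =~ f'.
Proof. intros <- <-; exists f; constructor. Qed.

Lemma hom_eq_dom {C : category} {A B A' B' : C} (f : hom A B) (g : hom A' B') :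
  f =~ g -> A = A'.
Proof. now intros []. Qed.

Lemma hom_eq_cod {C : category} {A B A' B' : C} (f : hom A B) (g : hom A' B') :
  f =~ g -> B = B'.
Proof. now intros []. Qed.

Lemma fmap_hom_eq {C D : category} (F : functor C D) {A B A' B' : C}
  (f : hom A B) (g : hom A' B') : f =~ g -> fmap F f =~ fmap F g.
Proof. intros []; constructor. Qed.

Section StructureHomEq.
Variable C : category.

Lemma pairing_hom_eq (S : cartesian C) (X A B X' A' B' : C)
  (f : hom X A) (g : hom X B) (f' : hom X' A') (g' : hom X' B') :
  f =~ f' -> g =~ g' -> pairing S f g =~ pairing S f' g'.
Proof.
intros Hf Hg; pose proof (hom_eq_dom Hf); pose proof (hom_eq_cod Hf).
pose proof (hom_eq_cod Hg); subst.
now rewrite (hom_eq_eq Hf), (hom_eq_eq Hg).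
Qed.

Lemma pr1_hom_eq (S : cartesian C) (A B A' B' : C) :
  A = A' -> B = B' -> pr1 S A B =~ pr1 S A' B'.
Proof. intros -> ->; constructor. Qed.

Lemma pr2_hom_eq (S : cartesian C) (A B A' B' : C) :
  A = A' -> B = B' -> pr2 S A B =~ pr2 S A' B'.
Proof. intros -> ->; constructor. Qed.

End StructureHomEq.

(** * Strict functors commute with pairing and transposition *)

Section StrictFunctors.
Variables (C D : category) (F : functor C D).

(** Uniqueness of pairings applies in [D] once the image is transported along [pres_prd], since its
    projections are then the given arrows. *)
Lemma fmap_pairing (SC : cartesian C) (SD : cartesian D)
  (HF : cartesian_functor SC SD F) (X A B : C) (X' A' B' : D)
  (f : hom X A) (g : hom X B) (f' : hom X' A') (g' : hom X' B') :
  fmap F f =~ f' -> fmap F g =~ g' ->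
  fmap F (pairing SC f g) =~ pairing SD f' g'.
Proof.
intros Hf Hg; pose proof (hom_eq_dom Hf); pose proof (hom_eq_cod Hf).
pose proof (hom_eq_cod Hg); subst.
destruct (hom_eq_cast (fmap F (pairing SC f g)) eq_refl (pres_prd HF A B))
  as [h Hh].
apply (hom_eq_trans Hh); rewrite (pairing_uniq h).
apply pairing_hom_eq.
- apply hom_eq_trans with (2 := Hf).
  rewrite <- (pr1_pairing SC f g); rewrite fmap_comp.
  apply hom_eq_comp; apply hom_eq_sym; [apply (pres_pr1 HF) | exact Hh].
- apply hom_eq_trans with (2 := Hg).
  rewrite <- (pr2_pairing SC f g); rewrite fmap_comp.
  apply hom_eq_comp; apply hom_eq_sym; [apply (pres_pr2 HF) | exact Hh].
Qed.

Lemma fmap_prd_map (SC : cartesian C) (SD : cartesian D)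
  (HF : cartesian_functor SC SD F) (X Y A B : C) (X' Y' A' B' : D)
  (f : hom X A) (g : hom Y B) (f' : hom X' A') (g' : hom Y' B') :
  fmap F f =~ f' -> fmap F g =~ g' ->
  fmap F (prd_map SC f g) =~ prd_map SD f' g'.
Proof.
intros Hf Hg; apply (fmap_pairing HF); rewrite fmap_comp; apply hom_eq_comp;
  try assumption.
- apply hom_eq_trans with (1 := pres_pr1 HF X Y).
  apply pr1_hom_eq; [apply (hom_eq_dom Hf) | apply (hom_eq_dom Hg)].
- apply hom_eq_trans with (1 := pres_pr2 HF X Y).
  apply pr2_hom_eq; [apply (hom_eq_dom Hf) | apply (hom_eq_dom Hg)].
Qed.

Variables (SC : cartesian_closed C) (SD : cartesian_closed D).
Hypothesis HF : cartesian_closed_functor SC SD F.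

Lemma fmap_uncurry (X A B : C) (X' A' B' : D)
  (g : hom X (ihom SC A B)) (g' : hom X' (ihom SD A' B')) :
  F A = A' -> F B = B' ->
  fmap F g =~ g' -> fmap F (uncurry g) =~ uncurry g'.
Proof.
intros <- <- Hg; unfold uncurry; rewrite fmap_comp; apply hom_eq_comp.
- apply (pres_ev HF).
- apply (fmap_prd_map (ccf_cart HF)); [exact Hg |].
  rewrite fmap_id; constructor.
Qed.

(** Transposes are unique: the image of [curry SC f], transported along [pres_ihom], uncurries to
    [f']. *)
Lemma fmap_curry (X A B : C) (X' A' B' : D)
  (f : hom (prd SC X A) B) (f' : hom (prd SD X' A') B') :
  F X = X' -> F A = A' ->
  fmap F f =~ f' -> fmap F (curry SC f) =~ curry SD f'.
Proof.
intros <- <- Hf; pose proof (hom_eq_cod Hf); subst B'.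
destruct (hom_eq_cast (fmap F (curry SC f)) eq_refl (pres_ihom HF A B))
  as [h Hh].
apply (hom_eq_trans Hh).
rewrite <- (curry_uncurry h).
replace f' with (uncurry h); [constructor |].
apply hom_eq_eq, hom_eq_trans with (2 := Hf).
rewrite <- (uncurry_curry f); apply hom_eq_sym.
now apply fmap_uncurry.
Qed.

End StrictFunctors.

(** * Cocartesian arrows *)

Section Cocartesian.
Variables (E B : category) (p : functor E B).

(* [is_cocartesian], with the arrow of the base given up to [=~]. *)
Definition cocartesian_over (X Y : B) (f : hom X Y) (U V : E)
    (psi : hom U V) : Prop :=
  forall (Z : B) (W : E) (g : hom Y Z) (w : hom U W),
    fmap p w =~ g \o f ->
    exists! h : hom V W, fmap p h =~ g /\ h \o psi = w.

Lemma cocartesian_over_hom_eq (X Y X' Y' : B) (f : hom X Y) (f' : hom X' Y')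
  (U V : E) (psi : hom U V) :
  f =~ f' -> cocartesian_over f psi -> cocartesian_over f' psi.
Proof. now intros []. Qed.

Lemma cocart_lift_cocartesian_over (ocl : opcleavage p) (X Y : B) (f : hom X Y)
  (U : fiber_ob p X) : cocartesian_over f (cocart_lift ocl f U).
Proof.
intros Z W g w Hw.
apply (cocartesian_factor (f := f) (W := FiberOb (hom_eq_cod Hw)));
  [apply cocart_lift_cocartesian | apply cocart_lift_over | exact Hw].
Qed.

(** The cartesian lifting is the cocartesian lifting of [f] at [pull cl f V] followed by the counit,
    and a cocartesian arrow followed by a vertical isomorphism remains cocartesian. *)
Lemma reflective_cart_lift (cl : cleavage p) (ocl : opcleavage p) (X Y : B)
  (f : hom X Y) (V : fiber_ob p Y) :
  reflective cl ocl f -> cocartesian_over f (cart_lift cl f V).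
Proof.
intros Hf Z W g w Hw.
destruct (Hf V) as [k [ke ek]].
apply (f_equal (@fib_hom _ _ _ _ _ _)) in ke, ek; simpl in ke, ek.
set (e := the (counit_exists cl ocl f V)) in ke, ek.
assert (He : fmap p e =~ idm Y /\ e \o cocart_lift ocl f (pull cl f V) =
  cart_lift cl f V) by exact (the_spec (counit_exists cl ocl f V)).
clearbody e; destruct He as [He Hel].
destruct (cocart_lift_cocartesian_over ocl Hw) as [h [[hg hw] hu]].
exists (h \o fib_hom k); split; [split |].
- rewrite fmap_comp, <- (comp_idr g); apply hom_eq_comp; [exact hg |].
  apply fib_hom_over.
- rewrite <- Hel, <- comp_assoc, (comp_assoc (fib_hom k)), ke, comp_idl.
  exact hw.
- intros h' [h'g h'w].
  rewrite (hu (h' \o e)).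
  + now rewrite <- comp_assoc, ek, comp_idr.
  + split; [|now rewrite <- comp_assoc, Hel].
    rewrite fmap_comp, <- (comp_idr g); apply hom_eq_comp; assumption.
Qed.

Variables (SE : cartesian_closed E) (SB : cartesian_closed B).
Hypothesis hp : cartesian_closed_functor SE SB p.

Lemma fmap_swap (U V : E) (X Y : B) : p U = X -> p V = Y ->
  fmap p (swap SE U V) =~ swap SB X Y.
Proof.
intros <- <-; apply (fmap_pairing (ccf_cart hp)).
- apply (pres_pr2 (ccf_cart hp)).
- apply (pres_pr1 (ccf_cart hp)).
Qed.

(** Since [p] preserves transposition, arrows [V x A -> W] over [g] correspond to arrows [V ->
    [A, W]] over the transpose of [g]. Factoring through [psi x A] thus reduces to factoring through
    [psi]. *)
Lemma cocartesian_prd_id (X Y Z : B) (f : hom X Y) (U V A : E)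
  (psi : hom U V) :
  p A = Z -> fmap p psi =~ f -> cocartesian_over f psi ->
  cocartesian_over (prd_map SB f (idm Z)) (prd_map SE psi (idm A)).
Proof.
intros <- Hpsi H T W g w Hw.
pose proof (hom_eq_cod Hw); subst T.
assert (Hc : fmap p (curry SE w) =~ curry SB g \o f).
{ rewrite curry_comp; apply (fmap_curry hp); [|reflexivity | exact Hw].
  apply (hom_eq_dom Hpsi). }
destruct (H _ _ _ _ Hc) as [h [[hg hw] hu]].
exists (uncurry h); split; [split |].
- rewrite <- (uncurry_curry g); now apply (fmap_uncurry hp).
- now rewrite <- uncurry_comp, hw, uncurry_curry.
- intros k [kg kw].
  rewrite (hu (curry SE k)); [apply uncurry_curry |]; split.
  + apply (fmap_curry hp); [|reflexivity | exact kg].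
    apply (hom_eq_cod Hpsi).
  + now rewrite curry_comp, kw.
Qed.

(** The product arrow is [psi x U'] followed by [V x psi']. The first is handled by
    [cocartesian_prd_id], the second as well after exchanging the factors. *)
Lemma cocartesian_prd (X Y X' Y' : B) (f : hom X Y) (f' : hom X' Y')
  (U V U' V' : E) (psi : hom U V) (psi' : hom U' V') :
  fmap p psi =~ f -> cocartesian_over f psi ->
  fmap p psi' =~ f' -> cocartesian_over f' psi' ->
  cocartesian_over (prd_map SB f f') (prd_map SE psi psi').
Proof.
intros Hf H Hf' H' Z W g w Hw.
assert (eU' := hom_eq_dom Hf'); assert (eV := hom_eq_cod Hf).
assert (eV' := hom_eq_cod Hf').
assert (Hw1 : fmap p w =~
  (g \o prd_map SB (idm Y) f') \o prd_map SB f (idm X')).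
{ now rewrite <- comp_assoc, prd_map_comp, comp_idl, comp_idr. }
destruct (cocartesian_prd_id eU' Hf H Hw1) as [w1 [[w1g w1w] w1u]].
assert (Hw2 : fmap p (w1 \o swap SE U' V) =~
  (g \o swap SB Y' Y) \o prd_map SB f' (idm Y)).
{ rewrite <- comp_assoc, swap_prd_map, comp_assoc, fmap_comp.
  apply hom_eq_comp; [exact w1g | now apply fmap_swap]. }
destruct (cocartesian_prd_id eV Hf' H' Hw2) as [w2 [[w2g w2w] w2u]].
exists (w2 \o swap SE V V'); split; [split |].
- rewrite <- (comp_idr g), <- (swap_swap SB Y Y'), comp_assoc, fmap_comp.
  apply hom_eq_comp; [exact w2g | now apply fmap_swap].
- replace (prd_map SE psi psi')
    with (prd_map SE (idm V) psi' \o prd_map SE psi (idm U'))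
    by now rewrite prd_map_comp, comp_idl, comp_idr.
  rewrite comp_assoc, <- (comp_assoc w2), swap_prd_map, (comp_assoc w2), w2w.
  now rewrite <- (comp_assoc w1), swap_swap, comp_idr.
- intros k [kg kw].
  rewrite (w2u (k \o swap SE V' V)).
  + now rewrite <- comp_assoc, swap_swap, comp_idr.
  + split.
    * rewrite fmap_comp; apply hom_eq_comp; [exact kg | now apply fmap_swap].
    (* The restriction of [k] along [V x psi'] factors [w] through [psi x U'], so it is [w1]. *)
    * rewrite <- comp_assoc, swap_prd_map, comp_assoc; f_equal.
      symmetry; apply w1u; split.
      -- rewrite fmap_comp; apply hom_eq_comp; [exact kg |].
         apply (fmap_prd_map (ccf_cart hp)); [|exact Hf'].
         rewrite fmap_id; now apply hom_eq_id.
      -- now rewrite <- comp_assoc, prd_map_comp, comp_idl, comp_idr.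
Qed.

End Cocartesian.

(** * Structures from universal properties *)

Definition is_terminal {C : category} (T : C) : Prop :=
  forall X, exists! f : hom X T, True.

Definition is_product {C : category} {P A B : C} (q1 : hom P A) (q2 : hom P B) :
    Prop :=
  forall X (f : hom X A) (g : hom X B),
    exists! h : hom X P, q1 \o h = f /\ q2 \o h = g.

Definition is_exponential {C : category} (S : cartesian C) {H A B : C}
    (e : hom (prd S H A) B) : Prop :=
  forall X (f : hom (prd S X A) B),
    exists! g : hom X H, e \o prd_map S g (idm A) = f.

Record product_cone (C : category) (A B : C) := ProductCone {
  pc_ob : C;
  pc_pr1 : hom pc_ob A;
  pc_pr2 : hom pc_ob B;
  pc_product : is_product pc_pr1 pc_pr2
}.

Record exponential (C : category) (S : cartesian C) (A B : C) := Exponential {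
  exp_ob : C;
  exp_ev : hom (prd S exp_ob A) B;
  exp_exponential : is_exponential exp_ev
}.

Lemma is_product_ext {C : category} {P A B : C} (q1 : hom P A) (q2 : hom P B)
  (X : C) (h k : hom X P) :
  is_product q1 q2 -> q1 \o h = q1 \o k -> q2 \o h = q2 \o k -> h = k.
Proof.
intros H e1 e2; destruct (H X (q1 \o k) (q2 \o k)) as [m [_ u]].
now rewrite <- (u h), <- (u k).
Qed.

Section Build.
Variable C : category.

Definition cartesian_of_cones (T : C) (HT : is_terminal T)
  (pc : forall A B : C, product_cone A B) : cartesian C.
Proof.
refine (@Cartesian C T (fun X => the (HT X)) _
  (fun A B => pc_ob (pc A B))
  (fun A B => pc_pr1 (pc A B)) (fun A B => pc_pr2 (pc A B))
  (fun X A B f g => the (pc_product (pc A B) f g)) _ _ _).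
- intros X f; symmetry; now apply the_uniq.
- intros X A B f g; exact (proj1 (the_spec (pc_product (pc A B) f g))).
- intros X A B f g; exact (proj2 (the_spec (pc_product (pc A B) f g))).
- intros X A B h; symmetry; now apply the_uniq.
Defined.

Definition cartesian_closed_of (S : cartesian C)
  (ex : forall A B : C, exponential S A B) : cartesian_closed C.
Proof.
refine (@CartesianClosed C S (fun A B => exp_ob (ex A B))
  (fun A B => exp_ev (ex A B))
  (fun X A B f => the (exp_exponential (ex A B) f)) _ _).
- intros X A B f; rewrite <- prd_map_idr.
  exact (the_spec (exp_exponential (ex A B) f)).
- intros X A B g; symmetry; apply the_uniq.
  now rewrite prd_map_idr.
Defined.

Lemma one_terminal (S : cartesian C) : is_terminal (one S).
Proof.
intros X; exists (bang S X); split; [trivial |].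
intros f _; symmetry; apply bang_uniq.
Qed.

Lemma pr_product (S : cartesian C) (A B : C) :
  is_product (pr1 S A B) (pr2 S A B).
Proof.
intros X f g; exists (pairing S f g); split.
- split; [apply pr1_pairing | apply pr2_pairing].
- intros h [<- <-]; symmetry; apply (pairing_uniq h).
Qed.

Lemma ev_exponential (S : cartesian_closed C) (A B : C) :
  is_exponential (ev S A B).
Proof.
intros X f; exists (curry S f); split; [apply uncurry_curry |].
intros g <-; apply curry_uncurry.
Qed.

Lemma is_product_iso (P A B A' B' : C) (q1 : hom P A) (q2 : hom P B)
  (a : hom A A') (a' : hom A' A) (b : hom B B') (b' : hom B' B) :
  inverse_of a a' -> inverse_of b b' -> is_product q1 q2 ->
  is_product (a \o q1) (b \o q2).
Proof.
intros [a'a aa'] [b'b bb'] H X f g.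
destruct (H X (a' \o f) (b' \o g)) as [h [[h1 h2] hu]]; exists h; split.
- rewrite <- !comp_assoc, h1, h2, !comp_assoc, aa', bb', !comp_idl; now split.
- intros k [<- <-]; apply hu.
  now rewrite <- !comp_assoc, (comp_assoc a'), (comp_assoc b'), a'a, b'b,
    !comp_idl.
Qed.

(** Conjugating [f] by the isomorphisms and by the change of products reduces the claim to [e]. It
    serves to pass to representatives of objects, and to move exponentials of [D] to another choice
    of products. *)
Lemma is_exponential_transfer (S S' : cartesian C) (H A B A' B' : C)
  (e : hom (prd S H A) B)
  (a : hom A' A) (a' : hom A A') (b : hom B B') (b' : hom B' B) :
  inverse_of a a' -> inverse_of b b' -> is_exponential e ->
  is_exponential (S := S')
    (b \o (e \o pairing S (pr1 S' H A') (a \o pr2 S' H A'))).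
Proof.
intros [a'a aa'] [b'b bb'] He X f.
destruct (He X (b' \o (f \o pairing S' (pr1 S X A) (a' \o pr2 S X A))))
  as [g [hg gu]].
(* The change of products is natural in the first factor, so [k] can be moved past it. *)
assert (key : forall k : hom X H,
  e \o pairing S (pr1 S' H A') (a \o pr2 S' H A') \o prd_map S' k (idm A') =
  e \o prd_map S k (idm A) \o pairing S (pr1 S' X A') (a \o pr2 S' X A')).
{ intros k; rewrite <- !comp_assoc, prd_map_pairing, pairing_comp.
  now rewrite <- comp_assoc, pr1_prd_map, pr2_prd_map, !comp_idl. }
exists g; split.
- rewrite <- comp_assoc, key, hg.
  rewrite !comp_assoc, bb', comp_idl, <- comp_assoc, pairing_comp.
  rewrite <- !comp_assoc, pr1_pairing, pr2_pairing, comp_assoc, a'a, comp_idl.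
  now rewrite pairing_id, comp_idr.
- intros k <-; apply gu.
  rewrite <- (comp_assoc b), key, <- comp_assoc, comp_assoc, b'b, comp_idl.
  rewrite <- comp_assoc, pairing_comp, <- !comp_assoc, pr1_pairing, pr2_pairing.
  now rewrite (comp_assoc a), aa', comp_idl, pairing_id, comp_idr.
Qed.

End Build.
Arguments one_terminal {C} S X.
Arguments pr_product {C} S A B X f g.
Arguments ev_exponential {C} S A B X f.

(** * The pullback is cartesian closed *)

Section PullbackStructure.
Variables (E B C : category).
Variables (SE : cartesian_closed E) (SB : cartesian_closed B).
Variable SC : cartesian_closed C.
Variable p : functor E B.
Hypothesis hp : cartesian_closed_functor SE SB p.
Variable F : functor C B.
Hypothesis hF : cartesian_functor SC SB F.

Let hpc := ccf_cart hp.

Lemma pb_one_over : p (one SE) = F (one SC).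
Proof. now rewrite (pres_one hpc), (pres_one hF). Qed.

Lemma pb_prd_over (U V : pb_ob p F) :
  p (prd SE (pb_fib U) (pb_fib V)) = F (prd SC (pb_base U) (pb_base V)).
Proof. now rewrite (pres_prd hpc), (pres_prd hF), !fib_over. Qed.

Definition pb_one : pb_ob p F := PbOb (one SC) (FiberOb pb_one_over).

Definition pb_prd (U V : pb_ob p F) : pb_ob p F :=
  PbOb (prd SC (pb_base U) (pb_base V)) (FiberOb (pb_prd_over U V)).

(** Both sides, transported to arrows into the terminal object of [B], agree there. *)
Lemma pb_bang_over (U : pb_ob p F) :
  fmap p (bang SE (pb_fib U)) =~ fmap F (bang SC (pb_base U)).
Proof.
destruct (hom_eq_cast (fmap p (bang SE (pb_fib U))) (fib_over (pb_fib U))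
  (pres_one hpc)) as [f Hf].
destruct (hom_eq_cast (fmap F (bang SC (pb_base U))) eq_refl (pres_one hF))
  as [g Hg].
apply (hom_eq_trans Hf), hom_eq_sym, (hom_eq_trans Hg).
rewrite (bang_uniq f), (bang_uniq g); constructor.
Qed.

Lemma pb_pr1_over (U V : pb_ob p F) :
  fmap p (pr1 SE (pb_fib U) (pb_fib V)) =~
  fmap F (pr1 SC (pb_base U) (pb_base V)).
Proof.
apply (hom_eq_trans (pres_pr1 hpc _ _)), hom_eq_sym.
apply (hom_eq_trans (pres_pr1 hF _ _)).
apply pr1_hom_eq; symmetry; apply fib_over.
Qed.

Lemma pb_pr2_over (U V : pb_ob p F) :
  fmap p (pr2 SE (pb_fib U) (pb_fib V)) =~
  fmap F (pr2 SC (pb_base U) (pb_base V)).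
Proof.
apply (hom_eq_trans (pres_pr2 hpc _ _)), hom_eq_sym.
apply (hom_eq_trans (pres_pr2 hF _ _)).
apply pr2_hom_eq; symmetry; apply fib_over.
Qed.

Lemma pb_pairing_over (U V W : pb_ob p F) (f : pb_hom U V) (g : pb_hom U W) :
  fmap p (pairing SE (pb_fhom f) (pb_fhom g)) =~
  fmap F (pairing SC (pb_bhom f) (pb_bhom g)).
Proof.
apply hom_eq_trans with (pairing SB (fmap F (pb_bhom f)) (fmap F (pb_bhom g))).
- apply (fmap_pairing hpc); apply pb_over.
- apply hom_eq_sym, (fmap_pairing hF); constructor.
Qed.

Definition pb_cartesian : cartesian (pullback p F).
Proof.
refine (@Cartesian (pullback p F) pb_one
  (fun U => PbHom (V := pb_one) (pb_bang_over U)) _ pb_prd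
  (fun U V => PbHom (U := pb_prd U V) (pb_pr1_over U V))
  (fun U V => PbHom (U := pb_prd U V) (pb_pr2_over U V))
  (fun W U V f g => PbHom (V := pb_prd U V) (pb_pairing_over f g)) _ _ _);
intros; apply pb_hom_eq; simpl.
- apply bang_uniq.
- apply (bang_uniq (c := SE)).
- apply pr1_pairing.
- apply pr1_pairing.
- apply pr2_pairing.
- apply pr2_pairing.
- apply pairing_uniq.
- apply (pairing_uniq (c := SE)).
Defined.

Variable cl : cleavage p.

(* The exponential of [(C, U)] and [(D, V)] is the reindexing of [U => V] along
   the comparison [F (C => D) -> (F C => F D)]. *)
Lemma pb_exponential (U V : pullback p F) :
  exists (H : pullback p F) (e : hom (prd pb_cartesian H U) V),
    is_exponential e.
Proof.
destruct U as [X U], V as [Y V].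
(* [k0] is the image of evaluation, seen as an arrow [F [X, Y] x F X -> F Y]; its transpose [k]
   below is the comparison along which [I] is reindexed. *)
destruct (hom_eq_cast (fmap F (ev SC X Y)) (pres_prd hF _ _) eq_refl)
  as [k0 Hk0].
assert (eUV : p (ihom SE U V) = ihom SB (F X) (F Y))
  by now rewrite (pres_ihom hp), !fib_over.
set (I := FiberOb eUV).
set (k := curry SB k0).
set (lift := cart_lift cl k I).
assert (lift_over : fmap p lift =~ k) by apply cart_lift_over.
assert (ecurry : forall g : hom (pull cl k I) (ihom SE U V),
  fmap p g =~ k -> fmap p (uncurry g) =~ fmap F (ev SC X Y)).
{ intros g Hg; apply hom_eq_trans with (2 := hom_eq_sym Hk0).
  unfold k in Hg; rewrite <- (uncurry_curry k0).
  apply (fmap_uncurry hp); [apply fib_over | apply fib_over | exact Hg]. }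
set (H := PbOb (ihom SC X Y) (pull cl k I) : pullback p F).
exists H, (PbHom (U := pb_prd H (PbOb X U)) (V := PbOb Y V)
             (ecurry lift lift_over)).
intros [Z W] [f u Hu]; simpl in f, u, Hu.
destruct (hom_eq_cast (fmap F f) (pres_prd hF _ _) eq_refl) as [f' Hf'].
assert (Hc : fmap p (curry SE u) =~ curry SB f').
{ apply (fmap_curry hp); try apply fib_over.
  now apply hom_eq_trans with (2 := Hf'). }
(* The transpose of [u] lies over [curry SB f']. Splitting that arrow through [k] lets the transpose
   of [u] factor uniquely through the cartesian lifting of [k]. *)
assert (Hk : k \o fmap F (curry SC f) = curry SB f').
{ unfold k; rewrite curry_comp; f_equal; apply hom_eq_eq.
  apply hom_eq_trans with (2 := Hf').
  rewrite <- (uncurry_curry f) at 2; unfold uncurry; rewrite fmap_comp.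
  apply hom_eq_comp; [now apply hom_eq_sym |].
  apply hom_eq_sym, (fmap_prd_map hF); [constructor |].
  rewrite fmap_id; constructor. }
rewrite <- Hk in Hc.
destruct (cartesian_factor (W := W) (cart_lift_cartesian cl k I) lift_over Hc)
  as [h [[hf hu] huniq]].
exists (PbHom (U := PbOb Z W) (V := H) hf); split.
- apply pb_hom_eq; simpl; [apply uncurry_curry |].
  change (uncurry lift \o prd_map SE h (idm (fib_ob U)) = u).
  rewrite <- uncurry_comp, <- (uncurry_curry u); apply f_equal; exact hu.
- intros [f1 h1 H1] e.
  assert (e1 := f_equal (@pb_bhom _ _ _ _ _ _ _) e); simpl in e1.
  assert (e2 := f_equal (@pb_fhom _ _ _ _ _ _ _) e); simpl in e2.
  change (uncurry f1 = f) in e1.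
  change (uncurry lift \o prd_map SE h1 (idm (fib_ob U)) = u) in e2.
  rewrite <- uncurry_comp in e2.
  apply pb_hom_eq; simpl.
  + rewrite <- e1; apply curry_uncurry.
  + apply huniq; split.
    * rewrite <- e1, curry_uncurry; exact H1.
    * fold lift; rewrite <- e2; symmetry; apply curry_uncurry.
Qed.

Definition pb_cartesian_closed : cartesian_closed (pullback p F).
Proof.
refine (cartesian_closed_of (S := pb_cartesian) (fun U V => _)).
destruct (constructive_indefinite_description _ (pb_exponential U V)) as [H K].
destruct (constructive_indefinite_description _ K) as [e He].
exact (Exponential He).
Defined.

End PullbackStructure.

(** * Reflective subcategories *)

Definition fully_faithful {C D : category} (F : functor C D) : Prop :=
  forall (A B : C) (t : hom (F A) (F B)), exists! s : hom A B, fmap F s = t.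

Section Reflection.
Variables (C D : category) (F : functor C D).
Hypothesis ff : fully_faithful F.

Lemma fmap_inj (A B : C) (s s' : hom A B) : fmap F s = fmap F s' -> s = s'.
Proof.
intros e; destruct (ff (fmap F s')) as [t [_ u]].
now rewrite <- (u s), <- (u s').
Qed.

Definition universal_arrow (X : D) (L : C) (eta : hom X (F L)) : Prop :=
  forall (A : C) (t : hom X (F A)), exists! n : hom L A, fmap F n \o eta = t.

(* The arrow [z] plays the role of the unit of [X x F A], so the reflector
   preserves this product. *)
Definition reflects_products (SC : cartesian C) (SD : cartesian D)
    (X : D) (L : C) (eta : hom X (F L)) : Prop :=
  forall (A B : C) (z : hom (prd SD X (F A)) (F (prd SC L A)))
    (h : hom (prd SD X (F A)) (F B)),
    fmap F (pr1 SC L A) \o z = eta \o pr1 SD X (F A) ->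
    fmap F (pr2 SC L A) \o z = pr2 SD X (F A) ->
    exists! n : hom (prd SC L A) B, fmap F n \o z = h.

Lemma change_product (S S' : cartesian D) (A B : D) :
  pairing S' (pr1 S A B) (pr2 S A B) \o pairing S (pr1 S' A B) (pr2 S' A B)
  = idm _.
Proof. rewrite pairing_comp, pr1_pairing, pr2_pairing; apply pairing_id. Qed.

End Reflection.

(** * Structure preserved by a right adjoint whose reflector respects products *)

Section Preservation.
Variables (C D : category) (F : functor C D).
Hypothesis ff : fully_faithful F.
Variables (SC0 : cartesian C) (SD0 : cartesian D).
Hypothesis reflection : forall X : D, exists (L : C) (eta : hom X (F L)),
  universal_arrow eta /\ reflects_products SC0 SD0 eta.

(** Two choices of products are related by inverse comparisons; composing [z] and [h] with them
    moves the problem to [SC0] and [SD0]. *)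
Lemma reflects_products_change (SC : cartesian C) (SD : cartesian D)
  (X : D) (L : C) (eta : hom X (F L)) :
  reflects_products SC0 SD0 eta -> reflects_products SC SD eta.
Proof.
intros H A B z h z1 z2.
set (c := pairing SC0 (pr1 SC L A) (pr2 SC L A)).
set (c' := pairing SC (pr1 SC0 L A) (pr2 SC0 L A)).
set (d := pairing SD (pr1 SD0 X (F A)) (pr2 SD0 X (F A))).
set (d' := pairing SD0 (pr1 SD X (F A)) (pr2 SD X (F A))).
assert (dd' : d \o d' = idm _) by apply change_product.
assert (cc' : c \o c' = idm _) by apply change_product.
assert (c'c : c' \o c = idm _) by apply change_product.
destruct (H A B (fmap F c \o z \o d) (h \o d)) as [n [nz nu]].
- rewrite !comp_assoc, <- fmap_comp; unfold c, d; rewrite pr1_pairing, z1.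
  now rewrite <- comp_assoc, pr1_pairing.
- rewrite !comp_assoc, <- fmap_comp; unfold c, d; rewrite pr2_pairing, z2.
  now rewrite pr2_pairing.
- exists (n \o c); split.
  + rewrite <- (comp_idr (fmap F (n \o c) \o z)), <- (comp_idr h), <- dd'.
    now rewrite !comp_assoc, <- nz, fmap_comp, !comp_assoc.
  + intros m <-; rewrite (nu (m \o c')).
    * now rewrite <- comp_assoc, c'c, comp_idr.
    * rewrite !comp_assoc, <- fmap_comp, <- (comp_assoc m), c'c, comp_idr.
      reflexivity.
Qed.

(** Every arrow [X -> F T] is [eta] followed by the image of an arrow [L -> T], and there is only
    one of these. *)
Lemma terminal_preserved (T : C) : is_terminal T -> is_terminal (F T).
Proof.
intros HT X; destruct (reflection X) as [L [eta [He _]]].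
destruct (HT L) as [b [_ bu]].
exists (fmap F b \o eta); split; [trivial |].
intros f _; destruct (He T f) as [n [<- _]]; now rewrite (bu n).
Qed.

(** Pairs of arrows from [X] to [F A] and [F B] correspond to pairs from [L] to [A] and [B]. *)
Lemma product_preserved (P A B : C) (q1 : hom P A) (q2 : hom P B) :
  is_product q1 q2 -> is_product (fmap F q1) (fmap F q2).
Proof.
intros H X f g; destruct (reflection X) as [L [eta [He _]]].
destruct (He A f) as [n1 [e1 u1]], (He B g) as [n2 [e2 u2]].
destruct (H L n1 n2) as [n [[h1 h2] hu]].
exists (fmap F n \o eta); split.
- now rewrite !comp_assoc, <- !fmap_comp, h1, h2.
- intros k [k1 k2]; destruct (He P k) as [m [<- _]].
  rewrite (hu m); [reflexivity |].
  rewrite comp_assoc, <- fmap_comp in k1, k2.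
  now rewrite (u1 _ k1), (u2 _ k2).
Qed.

Lemma fmap_prd_map_comparison (SC : cartesian C) (SD : cartesian D)
  (A A' B B' : C) (f : hom A A') (g : hom B B') :
  prd_comparison SC SD F A' B' \o fmap F (prd_map SC f g) =
  prd_map SD (fmap F f) (fmap F g) \o prd_comparison SC SD F A B.
Proof.
unfold prd_comparison; rewrite pairing_comp, prd_map_pairing, <- !fmap_comp.
now rewrite pr1_prd_map, pr2_prd_map.
Qed.

(** Arrows [X x F A -> F B] correspond to arrows [L x A -> B] because the reflector respects this
    product, then to arrows [L -> H] by the exponential in [C], then to arrows [X -> F H] by the
    universal arrow. *)
Lemma exponential_preserved (SC : cartesian C) (SD : cartesian D) (H A B : C)
  (e : hom (prd SC H A) B) (k : hom (prd SD (F H) (F A)) (F (prd SC H A))) :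
  inverse_of (prd_comparison SC SD F H A) k ->
  is_exponential e -> is_exponential (fmap F e \o k).
Proof.
intros [kc ck] He X f.
destruct (reflection X) as [L [eta [Hu Hp]]].
apply (reflects_products_change (SC := SC) (SD := SD)) in Hp.
(* [z] is the arrow exhibiting [L x A] as the reflection of [X x F A]. *)
destruct (product_preserved (pr_product SC L A)
  (eta \o pr1 SD X (F A)) (pr2 SD X (F A))) as [z [[z1 z2] _]].
(* By naturality of the product comparison, uncurrying [fmap F m \o eta] in [D] amounts to
   uncurrying [m] in [C] and precomposing its image with [z]. *)
assert (key : forall m : hom L H,
  fmap F e \o k \o prd_map SD (fmap F m \o eta) (idm (F A)) =
  fmap F (e \o prd_map SC m (idm A)) \o z).
{ intros m; rewrite fmap_comp, <- !comp_assoc; f_equal.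
  rewrite <- (comp_idl (fmap F (prd_map _ _ _) \o z)), <- kc, <- comp_assoc.
  f_equal; rewrite comp_assoc, fmap_prd_map_comparison, fmap_id, <- comp_assoc.
  unfold prd_comparison; rewrite pairing_comp, z1, z2, prd_map_pairing.
  unfold prd_map; now rewrite comp_assoc. }
destruct (Hp A B z f z1 z2) as [n [nz nu]].
destruct (He L n) as [m [mn mu]].
exists (fmap F m \o eta); split.
- now rewrite key, mn.
- intros g hg; destruct (Hu H g) as [m' [<- _]].
  rewrite key in hg; now rewrite (mu m' (eq_sym (nu _ hg))).
Qed.

Lemma comparison_iso (SC : cartesian C) (SD : cartesian D) (A B : C) :
  is_iso (prd_comparison SC SD F A B).
Proof.
assert (HP := product_preserved (pr_product SC A B)).
destruct (HP _ (pr1 SD (F A) (F B)) (pr2 SD (F A) (F B))) as [k [[k1 k2] _]].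
exists k; unfold prd_comparison; split.
- apply (is_product_ext HP); rewrite comp_assoc, comp_idr.
  + now rewrite k1, pr1_pairing.
  + now rewrite k2, pr2_pairing.
- rewrite pairing_comp, k1, k2; apply pairing_id.
Qed.

(** Source and target of each comparison share a universal property, which supplies the inverse and,
    by uniqueness, both inverse laws. *)
Lemma weak_preservation (SC : cartesian_closed C) (SD : cartesian_closed D) :
  weak_cartesian_closed_functor SC SD F.
Proof.
split.
- destruct (terminal_preserved (one_terminal SC) (one SD)) as [k _].
  exists k; split.
  + destruct (terminal_preserved (one_terminal SC) (F (one SC))) as [i [_ iu]].
    now rewrite <- (iu (k \o _)), <- (iu (idm _)).
  + now rewrite (bang_uniq (_ \o k)), (bang_uniq (idm _)).
- intros A B; apply comparison_iso.
- intros A B k Hk.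
  assert (He := exponential_preserved Hk (ev_exponential SC A B)).
  set (e := fmap F (ev SC A B) \o k) in *.
  destruct (He _ (ev SD (F A) (F B))) as [g [ge gu]].
  exists g; split.
  + destruct (He _ e) as [i [_ iu]].
    rewrite <- (iu (g \o curry SD e)), <- (iu (idm _)); trivial.
    * now rewrite prd_map_id, comp_idr.
    * rewrite <- (comp_idl (idm (F A))), <- prd_map_comp, comp_assoc, ge.
      apply uncurry_curry.
  + rewrite curry_comp, ge, <- (curry_uncurry (idm _)); f_equal.
    unfold uncurry; now rewrite prd_map_id, comp_idr.
Qed.

End Preservation.

(** * Strictification *)

Section Strictification.
Variables (C D : category) (F : functor C D).
Hypothesis ff : fully_faithful F.
Variables (SC : cartesian_closed C) (SD : cartesian_closed D).
Hypothesis terminal_pres : forall T : C, is_terminal T -> is_terminal (F T).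
Hypothesis product_pres :
  forall (P A B : C) (q1 : hom P A) (q2 : hom P B),
    is_product q1 q2 -> is_product (fmap F q1) (fmap F q2).
Hypothesis exponential_pres :
  forall (SC : cartesian C) (SD : cartesian D) (H A B : C)
    (e : hom (prd SC H A) B) (k : hom (prd SD (F H) (F A)) (F (prd SC H A))),
    inverse_of (prd_comparison SC SD F H A) k ->
    is_exponential e -> is_exponential (fmap F e \o k).

(* [F] need not be injective on objects, so strict preservation forces the
   structure of [C] to depend on [A] only through [F A]: it is computed on a
   chosen object of each fibre of the object map. *)
Definition rep (A : C) : C := epsilon (inhabits A) (fun A' => F A' = F A).

Lemma rep_ob (A : C) : F (rep A) = F A.
Proof.
apply (epsilon_spec (inhabits A) (fun A' => F A' = F A)); now exists A.
Qed.

Lemma rep_eq (A A' : C) : F A = F A' -> rep A = rep A'.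
Proof.
intros e; unfold rep; rewrite (proof_irrelevance _ (inhabits A') (inhabits A)).
now rewrite e.
Qed.

(** Full faithfulness lifts the identity of [F A], cast along [rep_ob]. *)
Lemma rep_iso_exists (A : C) :
  exists! i : hom (rep A) A, fmap F i =~ idm (F A).
Proof.
destruct (hom_eq_cast (idm (F A)) (eq_sym (rep_ob A)) eq_refl) as [t Ht].
destruct (ff t) as [i [Hi iu]]; exists i; split.
- rewrite Hi; now apply hom_eq_sym.
- intros j Hj; apply iu, hom_eq_eq, (hom_eq_trans Hj Ht).
Qed.

Lemma rep_inv_exists (A : C) :
  exists! j : hom A (rep A), fmap F j =~ idm (F A).
Proof.
destruct (hom_eq_cast (idm (F A)) eq_refl (eq_sym (rep_ob A))) as [t Ht].
destruct (ff t) as [i [Hi iu]]; exists i; split.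
- rewrite Hi; now apply hom_eq_sym.
- intros j Hj; apply iu, hom_eq_eq, (hom_eq_trans Hj Ht).
Qed.

Definition rep_iso (A : C) : hom (rep A) A := the (rep_iso_exists A).
Definition rep_inv (A : C) : hom A (rep A) := the (rep_inv_exists A).

Lemma fmap_rep_iso (A : C) : fmap F (rep_iso A) =~ idm (F A).
Proof. exact (the_spec (rep_iso_exists A)). Qed.

Lemma fmap_rep_inv (A : C) : fmap F (rep_inv A) =~ idm (F A).
Proof. exact (the_spec (rep_inv_exists A)). Qed.

Lemma rep_inverse (A : C) : inverse_of (rep_iso A) (rep_inv A).
Proof.
split; apply (fmap_inj ff); rewrite fmap_comp, fmap_id; apply hom_eq_eq;
  rewrite <- (comp_idl (idm (F _))).
- apply hom_eq_trans with (idm (F A) \o idm (F A)).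
  + apply hom_eq_comp; [apply fmap_rep_inv | apply fmap_rep_iso].
  + rewrite !comp_idl; apply hom_eq_id; symmetry; apply rep_ob.
- apply hom_eq_comp; [apply fmap_rep_iso | apply fmap_rep_inv].
Qed.

(** The projections reach [A] and [B] through isomorphisms that [F] sends to identities, so the
    vertex and the images of the projections depend only on [F A] and [F B]. *)
Definition rep_cone (A B : C) : product_cone A B :=
  ProductCone (is_product_iso (rep_inverse A) (rep_inverse B)
                 (pr_product SC (rep A) (rep B))).

Definition rep_cartesian : cartesian C :=
  cartesian_of_cones (one_terminal SC) rep_cone.

Lemma inverse_of_sym {X Y : C} (f : hom X Y) (g : hom Y X) :
  inverse_of f g -> inverse_of g f.
Proof. intros []; now split. Qed.

(** The exponent is contravariant, whence the inverse isomorphism at [A]. *)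
Definition rep_exponential (A B : C) : exponential rep_cartesian A B :=
  Exponential (is_exponential_transfer (S' := rep_cartesian)
    (inverse_of_sym (rep_inverse A)) (rep_inverse B)
    (ev_exponential SC (rep A) (rep B))).

Definition rep_cartesian_closed : cartesian_closed C :=
  cartesian_closed_of rep_exponential.

Lemma fmap_rep_iso_comp (X A : C) (f : hom X (rep A)) :
  fmap F (rep_iso A \o f) =~ fmap F f.
Proof.
rewrite fmap_comp.
apply hom_eq_trans with (idm (F (rep A)) \o fmap F f).
- apply hom_eq_comp; [|constructor].
  apply (hom_eq_trans (fmap_rep_iso A)), hom_eq_id; symmetry; apply rep_ob.
- rewrite comp_idl; constructor.
Qed.

Lemma fmap_pr1_eq (A B A' B' : C) : F A = F A' -> F B = F B' ->
  fmap F (pr1 rep_cartesian A B) =~ fmap F (pr1 rep_cartesian A' B').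
Proof.
intros eA eB; apply (hom_eq_trans (fmap_rep_iso_comp _)), hom_eq_sym.
apply (hom_eq_trans (fmap_rep_iso_comp _)).
exact (fmap_hom_eq F
  (pr1_hom_eq SC (eq_sym (rep_eq eA)) (eq_sym (rep_eq eB)))).
Qed.

Lemma fmap_pr2_eq (A B A' B' : C) : F A = F A' -> F B = F B' ->
  fmap F (pr2 rep_cartesian A B) =~ fmap F (pr2 rep_cartesian A' B').
Proof.
intros eA eB; apply (hom_eq_trans (fmap_rep_iso_comp _)), hom_eq_sym.
apply (hom_eq_trans (fmap_rep_iso_comp _)).
exact (fmap_hom_eq F
  (pr2_hom_eq SC (eq_sym (rep_eq eA)) (eq_sym (rep_eq eB)))).
Qed.

Lemma fmap_ev_eq (A B A' B' : C) : F A = F A' -> F B = F B' ->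
  fmap F (ev rep_cartesian_closed A B) =~
  fmap F (ev rep_cartesian_closed A' B').
Proof.
(* What is left of evaluation once the outer [rep_iso] is dropped and the [rep_inv] and [rep_iso] of
   the exponent cancel: a formula in the representatives alone. *)
pose (e X Y := ev SC X Y \o
  pairing SC (rep_iso (ihom SC X Y) \o pr1 SC (rep (ihom SC X Y)) X)
    (pr2 SC (rep (ihom SC X Y)) X)).
assert (key : forall A B,
  fmap F (ev rep_cartesian_closed A B) =~ fmap F (e (rep A) (rep B))).
{ intros X Y; apply (hom_eq_trans (fmap_rep_iso_comp _)).
  unfold e; apply eq_hom_eq, f_equal, f_equal, f_equal.
  simpl; rewrite comp_assoc, (proj1 (rep_inverse X)); apply comp_idl. }
assert (e_eq : forall X Y X' Y', X = X' -> Y = Y' -> e X Y =~ e X' Y')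
  by (intros ? ? ? ? [] []; constructor).
intros eA eB; apply (hom_eq_trans (key _ _)), hom_eq_sym.
apply (hom_eq_trans (key _ _)).
exact (fmap_hom_eq F (e_eq _ _ _ _ (eq_sym (rep_eq eA)) (eq_sym (rep_eq eB)))).
Qed.

(** On a pair in the image of [F], take the image of the product of any preimages; other preimages
    give the same projections up to [=~]. Off the image, the product of [SD] is kept. *)
Lemma image_cone (X Y : D) :
  exists c : product_cone X Y, forall A B : C, F A = X -> F B = Y ->
    fmap F (pr1 rep_cartesian A B) =~ pc_pr1 c /\
    fmap F (pr2 rep_cartesian A B) =~ pc_pr2 c.
Proof.
destruct (classic (exists A B, F A = X /\ F B = Y)) as [[A [B [<- <-]]] | n].
- exists (ProductCone (product_pres (pr_product rep_cartesian A B))).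
  intros A' B' eA eB; split; [now apply fmap_pr1_eq | now apply fmap_pr2_eq].
- exists (ProductCone (pr_product SD X Y)).
  intros A B eA eB; destruct n; eauto.
Qed.

Lemma image_cartesian :
  exists S : cartesian D, cartesian_functor rep_cartesian S F.
Proof.
pose (c X Y := proj1_sig
  (constructive_indefinite_description _ (image_cone X Y))).
assert (Hc : forall A B,
  fmap F (pr1 rep_cartesian A B) =~ pc_pr1 (c (F A) (F B)) /\
  fmap F (pr2 rep_cartesian A B) =~ pc_pr2 (c (F A) (F B))).
{ intros A B; unfold c.
  now apply (proj2_sig
    (constructive_indefinite_description _ (image_cone _ _))). }
exists (cartesian_of_cones (terminal_pres (one_terminal SC)) c).
split; intros; try apply Hc; [reflexivity |].
exact (hom_eq_dom (proj1 (Hc A B))).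
Qed.

(** Strict preservation turns the comparison into an identity up to [=~], so composing the image of
    an evaluation with [k] does not change it up to [=~]. *)
Lemma strict_comparison (S : cartesian C) (S' : cartesian D) (A B : C) :
  cartesian_functor S S' F ->
  exists k,
    inverse_of (prd_comparison S S' F A B) k /\ k =~ idm (F (prd S A B)).
Proof.
intros H.
destruct (hom_eq_cast (idm (F (prd S A B))) (pres_prd H A B) eq_refl) as [k Hk].
exists k; split; [|now apply hom_eq_sym].
assert (Hc : prd_comparison S S' F A B =~ idm (F (prd S A B))).
{ unfold prd_comparison.
  apply hom_eq_trans with
    (pairing S' (pr1 S' (F A) (F B)) (pr2 S' (F A) (F B))).
  - apply pairing_hom_eq; [apply (pres_pr1 H) | apply (pres_pr2 H)].
  - rewrite pairing_id; apply hom_eq_id; symmetry; apply (pres_prd H). }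
split; apply hom_eq_eq.
- rewrite <- (comp_idl (idm _)).
  apply hom_eq_comp; [now apply hom_eq_sym | exact Hc].
- apply hom_eq_trans with (idm (F (prd S A B)) \o idm (F (prd S A B))).
  + apply hom_eq_comp; [exact Hc | now apply hom_eq_sym].
  + rewrite comp_idl; apply hom_eq_id, (pres_prd H).
Qed.

(** The same case distinction as in [image_cone], with evaluations in place of projections. *)
Lemma image_exponential (S : cartesian D) (X Y : D) :
  cartesian_functor rep_cartesian S F ->
  exists x : exponential S X Y, forall A B : C, F A = X -> F B = Y ->
    F (ihom rep_cartesian_closed A B) = exp_ob x /\
    fmap F (ev rep_cartesian_closed A B) =~ exp_ev x.
Proof.
intros HS.
destruct (classic (exists A B, F A = X /\ F B = Y)) as [[A [B [<- <-]]] | n].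
- destruct (strict_comparison (ihom rep_cartesian_closed A B) A HS)
    as [k [Hk k1]].
  exists (Exponential (exponential_pres Hk
    (ev_exponential rep_cartesian_closed A B))).
  intros A' B' eA eB; simpl; split.
  + now rewrite (rep_eq eA), (rep_eq eB).
  + apply (hom_eq_trans (fmap_ev_eq eA eB)).
    apply hom_eq_trans with
      (fmap F (ev rep_cartesian_closed A B) \o idm (F (prd rep_cartesian _ A))).
    * rewrite comp_idr; constructor.
    * apply hom_eq_comp; [constructor | now apply hom_eq_sym].
- assert (Hid : forall Z : D, inverse_of (idm Z) (idm Z))
    by (intros Z; split; apply comp_idl).
  (* Exponentials of [SD] evaluate on products of [SD]; they are rebased here on those of [S]. *)
  exists (Exponential (is_exponential_transfer (S' := S) (Hid X) (Hid Y)
    (ev_exponential SD X Y))).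
  intros A B eA eB; destruct n; eauto.
Qed.

(** Strictness holds by construction: [C] receives the structure computed on representatives, and
    [D] the image of that structure, completed by [SD] off the image. *)
Theorem strictification :
  exists (SC' : cartesian_closed C) (SD' : cartesian_closed D),
    cartesian_closed_functor SC' SD' F.
Proof.
destruct image_cartesian as [S HS].
pose (x X Y := proj1_sig
  (constructive_indefinite_description _ (image_exponential X Y HS))).
assert (Hx : forall A B,
  F (ihom rep_cartesian_closed A B) = exp_ob (x (F A) (F B)) /\
  fmap F (ev rep_cartesian_closed A B) =~ exp_ev (x (F A) (F B))).
{ intros A B; unfold x.
  now apply (proj2_sig (constructive_indefinite_description _
    (image_exponential _ _ HS))). }
exists rep_cartesian_closed, (cartesian_closed_of x).
split; [exact HS | |]; intros A B; apply Hx.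
Qed.

End Strictification.

(** * The functor [theta^*] *)

Section Theta.
Variables (E B C : category).
Variables (SE : cartesian_closed E) (SB : cartesian_closed B).
Variable SC : cartesian_closed C.
Variable p : functor E B.
Hypothesis hp : cartesian_closed_functor SE SB p.
Variables (F G : functor C B).
Hypotheses (hF : cartesian_functor SC SB F) (hG : cartesian_functor SC SB G).
Variable theta : nat_trans F G.
Variables (cl : cleavage p) (ocl : opcleavage p).
Hypothesis htheta : forall X : C, reflective cl ocl (theta X).

(** Uniqueness of factorizations through the cartesian lifting. *)
Lemma theta_star_ext (U : pb_ob p F) (V : pb_ob p G)
  (t t' : pb_hom U (theta_star_ob cl theta V)) :
  pb_bhom t = pb_bhom t' ->
  theta_star_lift cl theta V \o pb_fhom t =
  theta_star_lift cl theta V \o pb_fhom t' ->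
  t = t'.
Proof.
intros e1 e2; apply pb_hom_eq; [exact e1 |].
assert (H : fmap p (theta_star_lift cl theta V \o pb_fhom t) =~
  theta (pb_base V) \o
  fmap F (pb_bhom t : hom (pb_base U) (pb_base V))).
{ rewrite fmap_comp; apply hom_eq_comp.
  - apply cart_lift_over.
  - exact (pb_over t). }
destruct (cartesian_factor (cart_lift_cartesian cl _ _)
  (cart_lift_over cl _ _) H) as [h [_ hu]].
rewrite <- (hu (pb_fhom t)), <- (hu (pb_fhom t')); trivial; split; trivial.
- rewrite e1; exact (pb_over t').
- now symmetry.
- exact (pb_over t).
Qed.

Lemma theta_star_lift_comp (V W : pb_ob p G) (v : pb_hom V W) (X : E)
  (z : hom X (pb_fib (theta_star_ob cl theta V))) :
  theta_star_lift cl theta W \o (pb_fhom (theta_star_hom cl theta v) \o z) =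
  pb_fhom v \o (theta_star_lift cl theta V \o z).
Proof. now rewrite comp_assoc, theta_star_homE, comp_assoc. Qed.

(** Naturality of [theta] puts the base arrow in the form needed to factor through an arrow
    cocartesian over [theta (pb_base U)]. *)
Lemma theta_star_over (U : pb_ob p F) (V : pb_ob p G)
  (t : pb_hom U (theta_star_ob cl theta V)) :
  fmap p (theta_star_lift cl theta V \o pb_fhom t) =~
  fmap G (pb_bhom t) \o theta (pb_base U).
Proof.
rewrite <- naturality, fmap_comp.
apply hom_eq_comp; [apply cart_lift_over | exact (pb_over t)].
Qed.

(** Composing [t] with the lifting at [W] gives an arrow out of the reindexing of [V]; it factors
    uniquely through the lifting at [V], which is cocartesian by reflectivity. *)
Lemma theta_star_fully_faithful : fully_faithful (theta_star cl theta).
Proof.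
intros V W t.
change (pb_hom (theta_star_ob cl theta V) (theta_star_ob cl theta W)) in t.
destruct (reflective_cart_lift (V := pb_fib V) (@htheta (pb_base V))
  (theta_star_over t)) as [h [[hg hw] hu]].
exists (PbHom hg); split.
- apply theta_star_ext; [reflexivity |].
  exact (eq_trans (theta_star_homE cl theta (PbHom hg)) hw).
- intros v <-; apply pb_hom_eq; [reflexivity |].
  apply hu; split; [exact (pb_over v) |].
  symmetry; exact (theta_star_homE cl theta v).
Qed.

Definition theta_push (X : pb_ob p F) : pb_ob p G :=
  PbOb (pb_base X) (push ocl (theta (pb_base X)) (pb_fib X)).

Definition theta_cocart (X : pb_ob p F) :
    hom (pb_fib X) (pb_fib (theta_push X)) :=
  cocart_lift ocl (theta (pb_base X)) (pb_fib X).

(** The unit of the adjunction: the cocartesian lifting factored through the cartesian lifting over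
    the same arrow. *)
Lemma theta_unit (X : pb_ob p F) :
  exists eta : pb_hom X (theta_star_ob cl theta (theta_push X)),
    pb_bhom eta = idm _ /\
    theta_star_lift cl theta (theta_push X) \o pb_fhom eta = theta_cocart X.
Proof.
assert (H : fmap p (theta_cocart X) =~ theta (pb_base X) \o fmap F (idm _)).
{ rewrite fmap_id, comp_idr; apply cocart_lift_over. }
destruct (cartesian_factor (W := pb_fib X) (cart_lift_cartesian cl _ _)
  (cart_lift_over cl _ (pb_fib (theta_push X))) H) as [h [[hg hw] _]].
now exists (PbHom (V := theta_star_ob cl theta (theta_push X)) hg).
Qed.

(** Both sides have the same projections, by naturality of [theta] at [pr1] and [pr2]. *)
Lemma theta_prd (X Y : C) :
  prd_map SB (theta X) (theta Y) =~ theta (prd SC X Y).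
Proof.
destruct (hom_eq_cast (theta (prd SC X Y)) (pres_prd hF X Y) (pres_prd hG X Y))
  as [t Ht].
apply hom_eq_sym, (hom_eq_trans Ht), eq_hom_eq.
apply pairing_ext; rewrite ?pr1_prd_map, ?pr2_prd_map; apply hom_eq_eq.
- apply hom_eq_trans with (fmap G (pr1 SC X Y) \o theta (prd SC X Y)).
  + apply hom_eq_comp; apply hom_eq_sym; [apply (pres_pr1 hG) | exact Ht].
  + rewrite <- naturality; apply hom_eq_comp; [constructor |].
    apply (pres_pr1 hF).
- apply hom_eq_trans with (fmap G (pr2 SC X Y) \o theta (prd SC X Y)).
  + apply hom_eq_comp; apply hom_eq_sym; [apply (pres_pr2 hG) | exact Ht].
  + rewrite <- naturality; apply hom_eq_comp; [constructor |].
    apply (pres_pr2 hF).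
Qed.

(** Each universal property is the cocartesianness of an arrow of [E]: of [theta_cocart X] for the
    unit, and of its product with the lifting at [A] for products. *)
Lemma theta_reflection (X : pullback p F) :
  exists (L : pullback p G) (eta : hom X (theta_star cl theta L)),
    universal_arrow eta /\
    reflects_products (pb_cartesian hp hG) (pb_cartesian hp hF) eta.
Proof.
destruct (theta_unit X) as [eta [eb ef]].
exists (theta_push X), eta; split.
- intros A t; change (pb_hom X (theta_star_ob cl theta A)) in t.
  destruct (cocart_lift_cocartesian_over ocl (theta_star_over t))
    as [h [[hg hw] hu]].
  set (n := PbHom (U := theta_push X) hg : hom (theta_push X : pullback p G) A).
  exists n; split.
  + apply theta_star_ext.
    * change (pb_bhom t \o pb_bhom eta = pb_bhom t).
      now rewrite eb, comp_idr.
    * change (theta_star_lift cl theta A \o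
        (pb_fhom (theta_star_hom cl theta n) \o pb_fhom eta) =
        theta_star_lift cl theta A \o pb_fhom t).
      rewrite theta_star_lift_comp, ef; exact hw.
  + intros m <-; apply pb_hom_eq.
    * change (pb_bhom m \o pb_bhom eta = pb_bhom m).
      now rewrite eb, comp_idr.
    * apply hu.
      assert (em : pb_bhom (fmap (theta_star cl theta) m \o eta) = pb_bhom m).
      { change (pb_bhom m \o pb_bhom eta = pb_bhom m).
        now rewrite eb, comp_idr. }
      split.
      { apply (hom_eq_trans (pb_over m)), eq_hom_eq.
        exact (f_equal (fmap G) (eq_sym em)). }
      change (pb_fhom m \o theta_cocart X = theta_star_lift cl theta A \o
        (pb_fhom (theta_star_hom cl theta m) \o pb_fhom eta)).
      now rewrite theta_star_lift_comp, ef.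
- intros A A' z h z1 z2.
  set (P := prd (pb_cartesian hp hG) (theta_push X) A : pb_ob p G).
  set (Q := prd (pb_cartesian hp hF) X (theta_star cl theta A) : pb_ob p F).
  change (pb_hom Q (theta_star_ob cl theta P)) in z.
  change (pb_hom Q (theta_star_ob cl theta A')) in h.
  assert (zb : pb_bhom z = idm _).
  { apply (f_equal (@pb_bhom _ _ _ _ _ _ _)) in z1, z2.
    apply (pairing_ext (S := SC)); rewrite comp_idr.
    - apply (eq_trans z1).
      change (pb_bhom eta \o pr1 SC (pb_base X) (pb_base A) =
        pr1 SC (pb_base X) (pb_base A)).
      rewrite eb; apply comp_idl.
    - exact z2. }
  (* After composition with the lifting, the equations on [z] determine both projections. *)
  assert (zf : theta_star_lift cl theta P \o pb_fhom z =
    prd_map SE (theta_cocart X) (theta_star_lift cl theta A)).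
  { apply (f_equal (@pb_fhom _ _ _ _ _ _ _)) in z1, z2.
    apply (pairing_ext (S := SE));
      [refine (eq_trans _ (eq_sym (pr1_prd_map SE _ _))) |
       refine (eq_trans _ (eq_sym (pr2_prd_map SE _ _)))].
    - rewrite <- ef, <- comp_assoc.
      set (q := pr1 (pb_cartesian hp hG) (theta_push X) A).
      apply (eq_trans (eq_sym (theta_star_lift_comp (V := P) q (pb_fhom z)))).
      apply f_equal; exact z1.
    - set (q := pr2 (pb_cartesian hp hG) (theta_push X) A).
      apply (eq_trans (eq_sym (theta_star_lift_comp (V := P) q (pb_fhom z)))).
      apply f_equal; exact z2. }
  (* The first factor is cocartesian by choice, the second by reflectivity of
     [theta (pb_base A)]. *)
  assert (coc : cocartesian_over p (theta (pb_base P))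
    (prd_map SE (theta_cocart X) (theta_star_lift cl theta A))).
  { apply (cocartesian_over_hom_eq (theta_prd (pb_base X) (pb_base A))).
    apply (cocartesian_prd hp).
    - apply cocart_lift_over.
    - apply cocart_lift_cocartesian_over.
    - apply cart_lift_over.
    - apply (reflective_cart_lift (@htheta (pb_base A))). }
  destruct (coc _ _ _ _ (theta_star_over h)) as [n [[ng nw] nu]].
  set (N := PbHom (U := P) ng : hom (P : pullback p G) A').
  exists N; split.
  + apply theta_star_ext.
    * change (pb_bhom h \o pb_bhom z = pb_bhom h).
      rewrite zb; apply comp_idr.
    * apply (eq_trans (theta_star_lift_comp (V := P) N (pb_fhom z))).
      rewrite zf; exact nw.
  + intros M <-.
    assert (Mb : pb_bhom (fmap (theta_star cl theta) M \o z) = pb_bhom M).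
    { change (pb_bhom M \o pb_bhom z = pb_bhom M).
      rewrite zb; apply (comp_idr (pb_bhom M)). }
    apply pb_hom_eq; [exact Mb |].
    apply nu; split.
    * apply (hom_eq_trans (pb_over M)), eq_hom_eq.
      exact (f_equal (fmap G) (eq_sym Mb)).
    * rewrite <- zf.
      exact (eq_sym (theta_star_lift_comp (V := P) M (pb_fhom z))).
Qed.

End Theta.

Unset Implicit Arguments.

(** Strict preservation depends on the chosen products and internal homs of the pullbacks. The first
    half provides choices making it strict; the second shows that the canonical comparisons are
    invertible for every choice. *)
Theorem theorem4p6 (E B C : category)
  (SE : cartesian_closed E) (SB : cartesian_closed B) (SC : cartesian_closed C)
  (p : functor E B) (hp : cartesian_closed_bifibration SE SB p)
  (F G : functor C B)
  (hF : cartesian_functor SC SB F) (hG : cartesian_functor SC SB G)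
  (theta : nat_trans F G)
  (cl : cleavage p) (ocl : opcleavage p)
  (htheta : forall X : C, reflective cl ocl (theta X)) :
  (exists (SG : cartesian_closed (pullback p G))
          (SF : cartesian_closed (pullback p F)),
      cartesian_closed_functor SG SF (theta_star cl theta))
  /\
  (forall (SG : cartesian_closed (pullback p G))
          (SF : cartesian_closed (pullback p F)),
      weak_cartesian_closed_functor SG SF (theta_star cl theta)).
Proof.
destruct hp as [_ hpc].
assert (ff := theta_star_fully_faithful htheta).
assert (refl := theta_reflection hpc hF hG htheta).
split.
- apply (strictification ff (pb_cartesian_closed hpc hG cl)
           (pb_cartesian_closed hpc hF cl)).
  + exact (terminal_preserved refl).
  + exact (product_preserved refl).
  + exact (exponential_preserved refl).
- exact (weak_preservation refl).
Qed.
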